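(* Let $A=(\alpha_{ij})_{i,j\ge1}$ be a symmetric infinite real matrix whose non-diagonal entries $\alpha_{ij}$, $i<j$, are distinct positive real numbers, such that the sum $\sum_{i=1}^\infty\alpha_{i,i+1}$ of the superdiagonal entries is finite, and the triangle inequality $\alpha_{ij}\le\alpha_{ik}+\alpha_{kj}$ is satisfied for all $i,j,k$. Then $$\sup_{\substack{i,j,k\in\mathbb{N}\\ i\neq k\neq j}}\frac{\alpha_{ij}}{\alpha_{ik}+\alpha_{kj}}=1.$$
   Context: $\mathbb{N}=\{1,2,3,\ldots\}$. The condition $i\neq k\neq j$ means $i\neq k$ and $k\neq j$. Symmetric means $\alpha_{ij}=\alpha_{ji}$ for all $i,j$. *)

(* Defs.v *)
From mathcomp Require Import all_boot all_order all_algebra.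
From mathcomp Require Import all_classical all_reals all_analysis.

Set Implicit Arguments.
Unset Strict Implicit.
Unset Printing Implicit Defensive.

Import Order.TTheory GRing.Theory Num.Theory.
Import numFieldNormedType.Exports.

Local Open Scope classical_set_scope.
Local Open Scope ring_scope.

(* Infinite matrices indexed by {1, 2, 3, ...} are functions nat -> nat -> R,
   the index i : nat standing for i + 1; the shift preserves order and
   successors.  Indices may coincide unless stated otherwise: the triangle
   inequality includes the diagonal entries, and i = j is allowed in
   [triangle_ratios] (only i <> k and k <> j are excluded). *)

Definition triangle_inequality (R : realType) (alpha : nat -> nat -> R) : Prop :=
  forall i j k : nat, alpha i j <= alpha i k + alpha k j.

Definition triangle_ratios (R : realType) (alpha : nat -> nat -> R) : set R :=
  [set x | exists i j k : nat,
     [/\ i <> k, k <> j & x = alpha i j / (alpha i k + alpha k j)]].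

(* Main.v *)
Require Import Defs.
From mathcomp Require Import all_boot all_order all_algebra.
From mathcomp Require Import all_classical all_reals all_analysis.
From mathcomp Require Import lra.
Import Order.TTheory GRing.Theory Num.Theory.
Import numFieldNormedType.Exports.
Local Open Scope classical_set_scope.
Local Open Scope ring_scope.

(** If every ratio were at most [c < 1], adding the inequalities for the triples
    [(i, k; k+1)] and [(i, k+1; k)] would give
    [(1 - c) (alpha i k + alpha i k.+1) <= 2 c alpha k k.+1]. The superdiagonal
    tends to [0], so every row would tend to [0], and then
    [alpha 0 1 <= alpha 0 k + alpha 1 k] would force [alpha 0 1 <= 0]. *)

Section Ratios.
Variables (R : realType) (alpha : nat -> nat -> R).
Hypothesis alpha_sym : forall i j : nat, alpha i j = alpha j i.
Hypothesis alpha_pos : forall i j : nat, (i < j)%N -> 0 < alpha i j.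

Lemma offdiag_gt0 (i j : nat) : i <> j -> 0 < alpha i j.
Proof.
move=> /eqP; rewrite neq_ltn => /orP[|] ij; first exact: alpha_pos.
by rewrite alpha_sym; exact: alpha_pos.
Qed.

Lemma ratio_denom_gt0 (i j k : nat) :
  i <> k -> k <> j -> 0 < alpha i k + alpha k j.
Proof. by move=> ik kj; rewrite addr_gt0 // offdiag_gt0. Qed.

Lemma ubound_triangle_ratios : triangle_inequality alpha ->
  ubound (triangle_ratios alpha) 1.
Proof.
move=> tri _ [i [j [k [ik kj ->]]]].
by rewrite ler_pdivrMr ?ratio_denom_gt0 // mul1r.
Qed.

(** Add the ratio bounds for the two triples in which [k] and [k.+1] exchange roles. The right side
    is independent of [i], so a single [k] can serve two rows at once. *)
Lemma row_le_superdiag (c : R) (i k : nat) :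
  ubound (triangle_ratios alpha) c -> c < 1 -> (i < k)%N ->
  (1 - c) * alpha i k <= 2 * alpha k k.+1.
Proof.
move=> ubc c1 ik.
have rle (a b m : nat) : a <> m -> m <> b ->
    alpha a b <= c * (alpha a m + alpha m b).
  move=> am mb; rewrite -ler_pdivrMr ?ratio_denom_gt0 //.
  by apply: ubc; exists a, b, m.
have ik1 : (i < k.+1)%N by exact: ltnW.
have nik : i <> k by move=> E; rewrite E ltnn in ik.
have nik1 : i <> k.+1 by move=> E; rewrite E ltnn in ik1.
have nkk1 : k <> k.+1 by move/eqP; rewrite ltn_eqF.
have r1 := rle i k.+1 k nik nkk1.
have r2 := rle i k k.+1 nik1 (nesym nkk1).
rewrite (alpha_sym k.+1 k) in r2.
have e0 := alpha_pos _ _ (ltnSn k).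
have a1 := alpha_pos _ _ ik1.
(* In the sum of [r1] and [r2], [p1] discards the term in [alpha i k.+1] and [p2] weakens the factor
   [2 * c] to [2]. *)
have p1 : 0 <= (1 - c) * alpha i k.+1 by rewrite mulr_ge0 ?subr_ge0 // ltW.
have p2 : 0 <= (1 - c) * alpha k k.+1 by rewrite mulr_ge0 ?subr_ge0 // ltW.
lra.
Qed.

(** With [c < 1], rows [0] and [1] would both be small at a column [k] far out, too small for the
    triangle on [0], [1], [k]. *)
Lemma ubound_triangle_ratios_ge1 (c : R) : triangle_inequality alpha ->
  (fun i => alpha i i.+1) @ \oo --> 0 ->
  ubound (triangle_ratios alpha) c -> 1 <= c.
Proof.
move=> tri cv0 ubc; rewrite leNgt; apply/negP => c1.
have a01 := alpha_pos 0 1 isT.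
(* The [4] is [2 + 2], one factor [2] from the row bound of each of rows [0] and [1]. *)
have e_gt0 : 0 < (1 - c) * alpha 0 1 / 4.
  by rewrite divr_gt0 // mulr_gt0 // subr_gt0.
have [N _ small] := (cvgr0Pnorm_lt _).1 cv0 _ e_gt0.
(* Beyond [N], and also above both row indices [0] and [1]. *)
pose k := (N + 2)%N.
have k1 : (1 < k)%N by rewrite /k addn2.
have := small k (leq_addr _ _).
rewrite gtr0_norm ?alpha_pos //= => ek.
have r0 := row_le_superdiag c 0 k ubc c1 (ltnW k1).
have r1 := row_le_superdiag c 1 k ubc c1 k1.
have : (1 - c) * alpha 0 1 <= (1 - c) * (alpha 0 k + alpha 1 k).
  by rewrite ler_pM2l ?subr_gt0 // (alpha_sym 1 k).
lra.
Qed.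

End Ratios.

Theorem proposition4p9 (R : realType) (alpha : nat -> nat -> R)
  (alpha_sym : forall i j : nat, alpha i j = alpha j i)
  (alpha_pos : forall i j : nat, (i < j)%N -> 0 < alpha i j)
  (alpha_distinct : forall i j k l : nat, (i < j)%N -> (k < l)%N ->
     alpha i j = alpha k l -> i = k /\ j = l)
  (alpha_summable : cvgn (series (fun i : nat => alpha i i.+1)))
  (alpha_triangle : triangle_inequality alpha) :
  sup (triangle_ratios alpha) = 1.
Proof.
have ub1 := ubound_triangle_ratios _ _ alpha_sym alpha_pos alpha_triangle.
(* Both bounds on [sup] need a nonempty set, since [sup] of the empty set is [0] by default. *)
have nonempty : triangle_ratios alpha !=set0.
  by exists (alpha 0 2 / (alpha 0 1 + alpha 1 2)), 0%N, 2%N, 1%N.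
apply/eqP; rewrite eq_le; apply/andP; split; first exact: ge_sup.
apply: (ubound_triangle_ratios_ge1 _ _ alpha_sym alpha_pos) => //.
- exact: cvg_series_cvg_0.
- by apply: sup_upper_bound; split=> //; exists 1.
Qed.
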